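(* The set of Kendall rank correlation matrices of $d$-dimensional copulas is identical to the set of linear correlation matrices of $d$-dimensional Bernoulli random vectors with symmetric margins.
   Context: Let $d\ge 2$. A $d$-dimensional copula is a distribution function on $[0,1]^d$ with standard uniform margins. For $\boldsymbol{U}$ distributed according to a copula, the Kendall rank correlation matrix $P_\tau(\boldsymbol{U})$ is the $d\times d$ matrix with unit diagonal and $(i,j)$ entry ($i\ne j$) equal to Kendall's tau $2\kappa_{\{i,j\}}-1$, where $\kappa_{\{i,j\}} = \mathbb{P}(\{U_i\le U_i^*, U_j\le U_j^*\}\cup\{U_i^*\le U_i, U_j^*\le U_j\})$ and $\boldsymbol{U}^*$ is an independent copy of $\boldsymbol{U}$. A Bernoulli random vector $\boldsymbol{B}$ is a random vector with values in $\{0,1\}^d$; it has symmetric margins if $\mathbb{P}(B_i=1)=\tfrac12$ for all $i$. The linear correlation matrix is the matrix of pairwise Pearson correlations. *)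

(* Defs.v *)
From HB Require Import structures.
From mathcomp Require Import all_boot all_order all_algebra.
From mathcomp Require Import all_classical all_reals all_analysis.

Set Implicit Arguments.
Unset Strict Implicit.
Unset Printing Implicit Defensive.

Import Order.TTheory GRing.Theory Num.Theory.
Import numFieldNormedType.Exports.

Local Open Scope classical_set_scope.
Local Open Scope ring_scope.

(* A d-dimensional random vector is given by its components
   X : 'I_d -> {RV P >-> R}. *)

Definition joint_cdf (R : realType) (d : nat) (disp : measure_display)
    (T : measurableType disp) (P : probability T R)
    (X : 'I_d -> {RV P >-> R}) (x : 'I_d -> R) : R :=
  fine (P [set w | forall i, X i w <= x i]).

(* Laws are compared on measurable sets only: [distribution] and
   [uniform_prob] are total functions with unspecified values elsewhere. *)
Definition standard_uniform (R : realType) (disp : measure_display)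
    (T : measurableType disp) (P : probability T R) (X : {RV P >-> R}) : Prop :=
  forall A : set R, measurable A ->
    distribution P X A = uniform_prob (@ltr01 R) A.

(* A distribution function on [0,1]^d is identified with its canonical
   extension to R^d; uniform margins force the mass to lie in [0,1]^d. *)
Definition is_copula (R : realType) (d : nat) (C : ('I_d -> R) -> R) : Prop :=
  exists (disp : measure_display) (T : measurableType disp)
    (P : probability T R) (X : 'I_d -> {RV P >-> R}),
    C = joint_cdf X /\ forall i, standard_uniform (X i).

(* The vector and its independent copy are realised on T * T under P \x P as
   w |-> U(w.1) and w |-> U(w.2). *)
Definition kappa (R : realType) (d : nat) (disp : measure_display)
    (T : measurableType disp) (P : probability T R)
    (U : 'I_d -> {RV P >-> R}) (i j : 'I_d) : R :=
  fine ((P \x P)%E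
    ([set w | U i w.1 <= U i w.2 /\ U j w.1 <= U j w.2] `|`
     [set w | U i w.2 <= U i w.1 /\ U j w.2 <= U j w.1])).

Definition kendall_mx (R : realType) (d : nat) (disp : measure_display)
    (T : measurableType disp) (P : probability T R)
    (U : 'I_d -> {RV P >-> R}) : 'M[R]_d :=
  \matrix_(i, j) if i == j then 1 else 2 * kappa U i j - 1.

Definition pearson (R : realType) (disp : measure_display)
    (T : measurableType disp) (P : probability T R)
    (X Y : {RV P >-> R}) : R :=
  fine (covariance P X Y) /
    (Num.sqrt (fine ('V_P[X])%E) * Num.sqrt (fine ('V_P[Y])%E)).

Definition correlation_mx (R : realType) (d : nat) (disp : measure_display)
    (T : measurableType disp) (P : probability T R)
    (X : 'I_d -> {RV P >-> R}) : 'M[R]_d :=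
  \matrix_(i, j) pearson (X i) (X j).

Definition bernoulli_vector (R : realType) (d : nat) (disp : measure_display)
    (T : measurableType disp) (P : probability T R)
    (B : 'I_d -> {RV P >-> R}) : Prop :=
  forall i w, B i w = 0 \/ B i w = 1.

Definition symmetric_margins (R : realType) (d : nat) (disp : measure_display)
    (T : measurableType disp) (P : probability T R)
    (B : 'I_d -> {RV P >-> R}) : Prop :=
  forall i, P [set w | B i w = 1] = (2^-1)%:E.

Definition copula_kendall_matrices (R : realType) (d : nat) : set 'M[R]_d :=
  [set M | exists (disp : measure_display) (T : measurableType disp)
      (P : probability T R) (U : 'I_d -> {RV P >-> R}),
      is_copula (joint_cdf U) /\ M = kendall_mx U].

Definition symmetric_bernoulli_correlation_matrices (R : realType) (d : nat) :
    set 'M[R]_d :=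
  [set M | exists (disp : measure_display) (T : measurableType disp)
      (P : probability T R) (B : 'I_d -> {RV P >-> R}),
      [/\ bernoulli_vector B, symmetric_margins B & M = correlation_mx B]].

Arguments copula_kendall_matrices R d : clear implicits.
Arguments symmetric_bernoulli_correlation_matrices R d : clear implicits.

(* Main.v *)
From HB Require Import structures.
Require Import Defs.
From mathcomp Require Import all_boot all_order all_algebra.
From mathcomp Require Import all_classical all_reals all_analysis.
From mathcomp Require Import unstable measurable_realfun lra.

Set Implicit Arguments.
Unset Strict Implicit.
Unset Printing Implicit Defensive.

Import Order.TTheory GRing.Theory Num.Theory.
Import numFieldNormedType.Exports.

Local Open Scope classical_set_scope.
Local Open Scope ring_scope.

(** Both inclusions turn a random vector of one kind into one of the other kind
    whose matrix is the same.  Two formulas make the matrices comparable.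
    A Bernoulli variable with symmetric margin has variance 1/4, so that the
    correlation of B_i and B_j is 4 P(B_i = B_j = 1) - 1
    ([pearson_bernoulli]).  Kendall's tau is 2 kappa - 1, so that everything
    rests on computing concordance probabilities.

    From a copula to a Bernoulli vector: with U* an independent copy of U, take
    B_i = 1 when U_i <= U_i*, and B_i = 0 otherwise.  Exchanging U and U*
    preserves the joint law, and U_i = U_i* is a null event because a uniform
    law has no atom ([copula_margin_atomless], [product_ties_ae]).  Hence
    P(B_i = 1) = 1/2 ([product_le]), and the two halves of the concordance event
    have the same probability and a null intersection, which gives
    kappa = 2 P(B_i = B_j = 1) ([kappa_atomless]).

    From a Bernoulli vector to a copula: with V uniform on [0, 1] and
    independent of B, take U_i = V when B_i = 1, and U_i = 1 - V otherwise.
    This is a mixture of extremal copulas; its margins are uniform because the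
    uniform law is invariant under v |-> 1 - v ([mixture_uniform]).  All the
    U_i are at the same distance |V - 1/2| from 1/2.  Therefore, of two
    independent copies of (B, V), the one with the larger distance alone decides
    the order: each of its coordinates lies beyond the matching coordinate of
    the other copy, on its own side of 1/2.  So the pair i, j is concordant
    exactly when U_i and U_j of that copy are on the same side, that is, when
    its B_i and B_j agree ([mixture_concordant]).  Which copy is the farther one
    is independent of the B's, hence kappa = P(B_i = B_j) ([kappa_mixture]).
    The symmetric margins finally give P(B_i = B_j) = 2 P(B_i = B_j = 1)
    ([probability_agree]). *)

(** * Measurability and almost sure comparison of events *)

Section measurable_comparisons.
Context d (T : measurableType d) (R : realType) (f g : T -> R).
Hypotheses (mf : measurable_fun setT f) (mg : measurable_fun setT g).

Lemma measurable_le_set : measurable [set x | f x <= g x].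
Proof. by rewrite -[X in measurable X]setTI; exact: measurable_fun_le. Qed.

Lemma measurable_eq_set : measurable [set x | f x = g x].
Proof.
have : measurable_fun setT (fun x => f x == g x) by exact: measurable_fun_eqr.
move=> /(_ measurableT [set true] I); rewrite setTI.
by congr (measurable _); apply/seteqP; split => x /= /eqP.
Qed.

Lemma measurable_lt_set : measurable [set x | f x < g x].
Proof.
have : measurable_fun setT (fun x => f x < g x) by exact: measurable_fun_ltr.
by move=> /(_ measurableT [set true] I); rewrite setTI.
Qed.

End measurable_comparisons.

Lemma probability_fin_num d (T : measurableType d) (R : realType)
    (P : probability T R) (A : set T) :
  measurable A -> P A \is a fin_num.
Proof. exact: fin_num_measure. Qed.

Section almost_everywhere.
Context d (T : measurableType d) (R : realType) (P : probability T R).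
Local Open Scope ereal_scope.

Lemma le_probability_ae (A B : set T) : measurable A -> measurable B ->
  {ae P, forall w, A w -> B w} -> P A <= P B.
Proof.
move=> mA mB [N [mN PN ABN]]; rewrite -(measureU0 mB mN PN).
apply: le_measure; rewrite ?inE//; first exact: measurableU.
move=> w Aw; have [Bw|nBw] := pselect (B w); [by left|right].
by apply: ABN => /(_ Aw).
Qed.

Lemma eq_probability_ae (A B : set T) : measurable A -> measurable B ->
  {ae P, forall w, A w <-> B w} -> P A = P B.
Proof.
move=> mA mB AB; apply/eqP; rewrite eq_le.
by rewrite !le_probability_ae//; apply: filterS AB => w [].
Qed.

Lemma ae_probability1 (A : set T) : measurable A -> P A = 1 ->
  {ae P, forall w, A w}.
Proof.
move=> mA PA; exists (~` A); split => //; first exact: measurableC.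
by rewrite probability_setC// PA subee.
Qed.

End almost_everywhere.

(** * Two independent copies of a random element *)

Section independent_copy.
Context d (T : measurableType d) (R : realType) (P : probability T R).

(** The measure P x P and its variant that integrates the factors in the other
    order agree on rectangles, hence everywhere; the value of the variant on A
    is by definition that of P x P on the exchanged set. *)
Lemma product_swap (A : set (T * T)) : measurable A ->
  (P \x P)%E [set z | A (z.2, z.1)] = (P \x P)%E A.
Proof.
move=> mA.
rewrite [RHS](product_measure_unique (m' := (P \x^ P)%E)) //.
by move=> B C mB mC; exact: product_measure2E.
Qed.

Lemma measurable_swap_set (A : set (T * T)) : measurable A ->
  measurable [set z | A (z.2, z.1)].
Proof. by move=> mA; have := measurable_swap measurableT mA; rewrite setTI. Qed.

(** An event and its mirror image under the exchange of the two copies have the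
    same probability, so that these add up when their intersection is null.
    Concordance events have this shape in both halves of the proof. *)
Lemma product_symmetrize (A : set (T * T)) : measurable A ->
  {ae (P \x P)%E, forall z, A z -> ~ A (z.2, z.1)} ->
  fine ((P \x P)%E (A `|` [set z | A (z.2, z.1)])) = 2 * fine ((P \x P)%E A).
Proof.
move=> mA disj; set A' := [set z | A (z.2, z.1)].
have mA' : measurable A' by exact: measurable_swap_set.
have A'D : (P \x P)%E (A' `\` A) = (P \x P)%E A.
  rewrite -(product_swap mA); apply: eq_probability_ae => //.
    exact: measurableD.
  by apply: filterS disj => z dz; split => [[]//|A'z]; split => // /dz.
have -> : A `|` A' = A `|` (A' `\` A) by rewrite setUDr setDv setD0.
rewrite measureU//; last by rewrite setDE setICA setICr setI0.
  rewrite [X in (_ + X)%E]A'D fineD; [|exact: probability_fin_num..].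
  by rewrite mulr2n mulrDl mul1r.
exact: measurableD.
Qed.

Variables (X : T -> R) (mX : measurable_fun setT X).
Hypothesis X0 : forall x, P [set w | X w = x] = 0%E.

Let mX1 : measurable_fun setT (fun z : T * T => X z.1).
Proof. exact: measurableT_comp. Qed.

Let mX2 : measurable_fun setT (fun z : T * T => X z.2).
Proof. exact: measurableT_comp. Qed.

(** Given one copy, a tie forces the other copy into an atom. *)
Lemma product_ties_ae : {ae (P \x P)%E, forall z, X z.1 <> X z.2}.
Proof.
exists [set z | X z.1 = X z.2]; split.
- exact: measurable_eq_set.
- rewrite /product_measure1 integral0_eq// => x _ /=.
  rewrite xsectionE -[RHS](X0 (X x)); congr (P _).
  by apply/seteqP; split => y /=.
- by move=> z /= /contrapT.
Qed.

Lemma product_lt : fine ((P \x P)%E [set z | X z.2 < X z.1]) = 2^-1.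
Proof.
have mlt : measurable [set z : T * T | X z.2 < X z.1].
  exact: measurable_lt_set.
have lt_ae : {ae (P \x P)%E, forall z : T * T,
    X z.2 < X z.1 -> ~ X z.1 < X z.2}.
  by apply: aeW => z /lt_trans h /h; rewrite ltxx.
have := product_symmetrize mlt lt_ae.
rewrite (eq_probability_ae (B := setT))//.
- rewrite probability_setT/=; lra.
- by apply: measurableU => //; exact: measurable_swap_set.
- apply: filterS product_ties_ae => z; split => //= _.
  by case: (ltgtP (X z.1) (X z.2)) => // h; [right|left].
Qed.

Lemma product_le : fine ((P \x P)%E [set z | X z.1 <= X z.2]) = 2^-1.
Proof.
rewrite -product_lt -(product_swap (A := [set z | X z.2 < X z.1])).
  congr fine; apply: eq_probability_ae.
  - exact: measurable_le_set.
  - exact: measurable_lt_set.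
  - apply: filterS product_ties_ae => z /= /eqP ties.
    by rewrite lt_neqAle ties.
exact: measurable_lt_set.
Qed.

End independent_copy.

(** * Correlation of symmetric Bernoulli variables *)

Section bernoulli_pearson.
Context d (T : measurableType d) (R : realType) (P : probability T R).

Lemma indic_Lfun1 (A : set T) : measurable A -> (\1_A : T -> R) \in Lfun P 1.
Proof. by move=> mA; apply/Lfun1_integrable; exact: integrable_indic. Qed.

Lemma covariance_indic (A B : set T) : measurable A -> measurable B ->
  covariance P \1_A \1_B = (P (A `&` B) - P A * P B)%E.
Proof.
move=> mA mB.
have AB : (\1_A * \1_B)%R = \1_(A `&` B) :> (T -> R) by rewrite indicI.
have mAB : measurable (A `&` B) by exact: measurableI.
by rewrite covarianceE ?AB ?indic_Lfun1// !expectation_indic.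
Qed.

Lemma bernoulli_indic (X : T -> R) : (forall w, X w = 0 \/ X w = 1) ->
  X = \1_[set w | X w = 1].
Proof.
move=> X01; apply/funext => w; rewrite indicE.
by case: (X01 w) => Xw; [rewrite memNset//= Xw => /esym/eqP; rewrite oner_eq0
                       | rewrite mem_set].
Qed.

Lemma covariance_bernoulli (X Y : {RV P >-> R}) :
  (forall w, X w = 0 \/ X w = 1) -> (forall w, Y w = 0 \/ Y w = 1) ->
  covariance P X Y = (P [set w | X w = 1 /\ Y w = 1]%R -
    P [set w | X w = 1%R] * P [set w | Y w = 1%R])%E.
Proof.
move=> X01 Y01; rewrite -covariance_indic; try exact: measurable_eq_set.
by congr covariance; exact: bernoulli_indic.
Qed.

Lemma pearson_bernoulli (X Y : {RV P >-> R}) :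
  (forall w, X w = 0 \/ X w = 1) -> (forall w, Y w = 0 \/ Y w = 1) ->
  P [set w | X w = 1] = (2^-1)%:E -> P [set w | Y w = 1] = (2^-1)%:E ->
  pearson X Y = 4 * fine (P [set w | X w = 1 /\ Y w = 1]) - 1.
Proof.
move=> X01 Y01 PX PY.
have var_quarter (Z : {RV P >-> R}) : (forall w, Z w = 0 \/ Z w = 1) ->
    P [set w | Z w = 1] = (2^-1)%:E -> fine 'V_P[Z] = 4^-1.
  move=> Z01 PZ; rewrite /variance covariance_bernoulli// PZ.
  rewrite (_ : [set w | _] = [set w | Z w = 1]); last first.
    by apply/seteqP; split => w //= [].
  by rewrite PZ -EFinM -EFinB/=; lra.
have mXY : measurable [set w | X w = 1 /\ Y w = 1].
  by apply: measurableI; exact: measurable_eq_set.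
rewrite /pearson !var_quarter// -expr2 sqr_sqrtr ?invr_ge0//.
rewrite covariance_bernoulli// PX PY -(fineK (probability_fin_num P mXY)).
by rewrite -EFinM -EFinB/=; lra.
Qed.

End bernoulli_pearson.

(** * The margins of a copula have no atom *)

Section copula_margins.
Context (R : realType) (n : nat).

Lemma measurable_joint_le d (T : measurableType d) (P : probability T R)
    (X : 'I_n -> {RV P >-> R}) (x : 'I_n -> R) :
  measurable [set w | forall i, X i w <= x i].
Proof.
rewrite (_ : [set w | _] = \bigcap_(i in [set: 'I_n]) [set w | X i w <= x i]).
  apply: fin_bigcap_measurable => // i _; exact: measurable_le_set.
by apply/seteqP; split => w /= h i; [move=> _|]; exact: h.
Qed.

(** Evaluating at 1 in the other coordinates plays the part of a limit at
    infinity, since these coordinates are almost surely at most 1. *)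
Lemma joint_cdf_marginal d (T : measurableType d) (P : probability T R)
    (X : 'I_n -> {RV P >-> R}) (i : 'I_n) (x : R) :
  (forall j, P [set w | X j w <= 1] = 1%E) ->
  joint_cdf X (fun j => if j == i then x else 1) =
  fine (P [set w | X i w <= x]).
Proof.
move=> X1; rewrite /joint_cdf; congr fine; apply: eq_probability_ae.
- exact: measurable_joint_le.
- exact: measurable_le_set.
have : {ae P, forall w j, X j w <= 1}.
  apply: filter_forall => j; apply: ae_probability1 (X1 j).
  exact: measurable_le_set.
apply: filterS => w Xw1; split => /= [/(_ i)|Xix j]; first by rewrite eqxx.
by case: eqP => [->|].
Qed.

Lemma standard_uniform_le1 d (T : measurableType d) (P : probability T R)
    (X : {RV P >-> R}) : standard_uniform X -> P [set w | X w <= 1] = 1%E.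
Proof.
move=> XU; rewrite (_ : [set w | _] = X @^-1` `]-oo, 1]); last first.
  by apply/seteqP; split => w /=; rewrite in_itv.
have := XU `]-oo, 1]%classic (measurable_itv _).
rewrite /distribution /pushforward => ->.
by apply: (integral_uniform_pdf1 ltr01) => x /=; rewrite !in_itv/= => /andP[].
Qed.

Lemma uniform_prob_le_lebesgue (A : set R) : measurable A ->
  (uniform_prob (@ltr01 R) A <= lebesgue_measure A)%E.
Proof.
move=> mA; rewrite -[leRHS]mul1e -integral_cst// /uniform_prob.
apply: ge0_le_integral => //.
- by move=> x _; rewrite lee_fin uniform_pdf_ge0.
- apply/measurable_EFinP/measurable_funTS; exact: measurable_uniform_pdf.
- move=> x _ /=; rewrite lee_fin /uniform_pdf.
  by case: ifP => _; rewrite ?subr0 ?invr1.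
Qed.

Lemma standard_uniform_increment d (T : measurableType d) (P : probability T R)
    (X : {RV P >-> R}) (x e : R) : standard_uniform X -> 0 < e ->
  (P [set w | X w <= x]%R <= P [set w | X w <= x - e]%R + e%:E)%E.
Proof.
move=> XU e0.
rewrite (_ : [set w | X w <= x] =
    [set w | X w <= x - e] `|` X @^-1` `]x - e, x]); last first.
  apply/seteqP; split => w /=; rewrite in_itv/=.
    by move=> ->; rewrite andbT; case: (leP (X w) (x - e)); [left|right].
  by case=> [|/andP[]//]; lra.
apply: (le_trans (measureU2 _ _ _)); first exact: measurable_le_set.
  exact: measurable_funPTI.
rewrite leeD2l//.
rewrite (le_trans (_ : _ <= lebesgue_measure `](x - e)%R, x]%classic)%E)//.
  rewrite [leLHS](XU `]x - e, x]%classic (measurable_itv _)).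
  exact: uniform_prob_le_lebesgue.
by rewrite lebesgue_measure_itv/= lte_fin ifT ?gtrBl// -EFinB lee_fin; lra.
Qed.

(** By definition a copula is only the joint distribution function of some
    other vector X with uniform margins.  The bound 1 is first transferred from
    X to U, which makes [joint_cdf_marginal] available for both; U_i and X_i
    then have the same distribution function, whose increments over intervals
    of length e are at most e, and these bound every atom. *)
Lemma copula_margin_atomless d (T : measurableType d) (P : probability T R)
    (U : 'I_n -> {RV P >-> R}) (i : 'I_n) (x : R) :
  is_copula (joint_cdf U) -> P [set w | U i w = x] = 0%E.
Proof.
move=> [d' [T' [P' [X [UX XU]]]]].
have X1 j : P' [set w | X j w <= 1] = 1%E by exact: standard_uniform_le1.
have U1 j : P [set w | U j w <= 1] = 1%E.
  apply/eqP; rewrite eq_le probability_le1 ?andTb; last first.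
    exact: measurable_le_set.
  have U11 : joint_cdf U (fun _ => 1) = 1.
    rewrite UX (_ : (fun _ => 1) = (fun k => if k == j then 1 else 1)).
      by rewrite joint_cdf_marginal// X1.
    by apply/funext => k; rewrite if_same.
  have mU := measurable_joint_le U (fun _ => 1).
  rewrite -(congr1 EFin U11) /joint_cdf fineK ?probability_fin_num//.
  apply: le_measure; rewrite ?inE.
  - exact: measurable_joint_le.
  - exact: measurable_le_set.
  - by move=> w /=; exact.
have margin r : P [set w | U i w <= r] = P' [set w | X i w <= r].
  rewrite -[LHS]fineK ?probability_fin_num//; last exact: measurable_le_set.
  rewrite -[RHS]fineK ?probability_fin_num//; last exact: measurable_le_set.
  by rewrite -!joint_cdf_marginal// UX.
apply/eqP; rewrite eq_le measure_ge0 andbT; apply/lee_addgt0Pr => e e0.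
rewrite add0e -(@leeD2lE _ (P [set w | U i w <= x - e])); last first.
  by apply: probability_fin_num; exact: measurable_le_set.
rewrite -measureU//; last first.
- by rewrite -subset0 => w /= [] + Uw; rewrite Uw; lra.
- exact: measurable_eq_set.
- exact: measurable_le_set.
rewrite [in leRHS]margin.
apply: (le_trans _ (standard_uniform_increment x (XU i) e0)).
rewrite -margin; apply: le_measure; rewrite ?inE.
- apply: measurableU; [exact: measurable_le_set|exact: measurable_eq_set].
- exact: measurable_le_set.
- by move=> w /= [|->//]; lra.
Qed.

End copula_margins.

(** * From a copula to a Bernoulli vector *)

Section kendall_of_order_indicators.
Context d (T : measurableType d) (R : realType) (P : probability T R).
Context (n : nat) (U : 'I_n -> {RV P >-> R}).
Hypothesis U0 : forall i x, P [set w | U i w = x] = 0%E.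

Let mU1 i : measurable_fun setT (fun z : T * T => U i z.1).
Proof. exact: measurableT_comp. Qed.

Let mU2 i : measurable_fun setT (fun z : T * T => U i z.2).
Proof. exact: measurableT_comp. Qed.

(** Concordance may be replaced by any event that is almost surely equivalent;
    the mixture below uses this to discard the ties. *)
Lemma kappa_ae i j (A : set (T * T)) : measurable A ->
  {ae (P \x P)%E, forall z,
    (U i z.1 <= U i z.2 /\ U j z.1 <= U j z.2) \/
    (U i z.2 <= U i z.1 /\ U j z.2 <= U j z.1) <-> A z} ->
  kappa U i j = fine ((P \x P)%E A).
Proof.
move=> mA UA; rewrite /kappa; congr fine; apply: eq_probability_ae => //.
by apply: measurableU; apply: measurableI; exact: measurable_le_set.
Qed.

Lemma kappa_atomless i j : kappa U i j = 2 * fine ((P \x P)%E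
    [set z | U i z.1 <= U i z.2 /\ U j z.1 <= U j z.2]).
Proof.
rewrite -product_symmetrize//.
  by apply: measurableI; exact: measurable_le_set.
have mUi : measurable_fun setT (U i) by [].
apply: filterS (product_ties_ae mUi (U0 i)) => z tie [le1 _] [le2 _].
by apply: tie; apply/eqP; rewrite eq_le le1.
Qed.

Lemma measurable_order_set i : measurable [set z : T * T | U i z.1 <= U i z.2].
Proof. exact: measurable_le_set. Qed.

Definition order_indicator i : {RV (P \x P)%E >-> R} :=
  mindic R (measurable_order_set i).

Lemma order_indicatorE i z :
  order_indicator i z = (U i z.1 <= U i z.2)%R%:R.
Proof.
rewrite /order_indicator mindicE; congr (nat_of_bool _)%:R.
by apply/idP/idP => [/set_mem|/mem_set].
Qed.

Lemma bernoulli_order_indicator : bernoulli_vector order_indicator.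
Proof.
by move=> i z; rewrite order_indicatorE; case: (_ <= _); [right|left].
Qed.

Lemma order_indicatorP i z : order_indicator i z = 1 <-> U i z.1 <= U i z.2.
Proof.
rewrite order_indicatorE; case: (_ <= _); split => // /esym/eqP.
by rewrite oner_eq0.
Qed.

Lemma symmetric_order_indicator : symmetric_margins order_indicator.
Proof.
move=> i; rewrite (_ : [set w | _] = [set z | U i z.1 <= U i z.2]).
  have mUi : measurable_fun setT (U i) by [].
  rewrite -(product_le mUi (U0 i)) fineK//; apply: probability_fin_num.
  exact: measurable_order_set.
by apply/seteqP; split => z /order_indicatorP.
Qed.

Lemma kendall_order_indicator : kendall_mx U = correlation_mx order_indicator.
Proof.
apply/matrixP => i j; rewrite !mxE.
have B01 := bernoulli_order_indicator; have B2 := symmetric_order_indicator.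
rewrite pearson_bernoulli//.
have [<-|ij] := eqVneq i j.
  rewrite (_ : [set w | _] = [set w | order_indicator i w = 1]); last first.
    by apply/seteqP; split => w //= [].
  by rewrite B2/=; lra.
rewrite kappa_atomless (_ : [set w | order_indicator i w = 1 /\ _] =
  [set z | U i z.1 <= U i z.2 /\ U j z.1 <= U j z.2]); first lra.
by apply/seteqP; split => z [] /order_indicatorP ? /order_indicatorP ?.
Qed.

End kendall_of_order_indicators.

(** * The uniform law on [0, 1] *)

Section uniform_law.
Context (R : realType).
Local Notation unif := (uniform_prob (@ltr01 R)).

Let measurable_onem :
  measurable_fun [set: measurableTypeR R] (onem : _ -> measurableTypeR R).
Proof. exact: measurable_funB. Qed.

Lemma lebesgue_measure_onem (A : set R) : measurable A ->
  lebesgue_measure (onem @^-1` A) = lebesgue_measure A.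
Proof.
move=> mA; rewrite [RHS](lebesgue_measure_unique
  (mu := pushforward lebesgue_measure (onem : _ -> measurableTypeR R)))//.
move=> _ [[a b]] _ <-.
rewrite -[RHS]/(lebesgue_measure (onem @^-1` `]a, b])).
rewrite (_ : _ @^-1` _ = `[1 - b, 1 - a[%classic); last first.
  apply/seteqP; split => x /=; rewrite !in_itv/= /onem => /andP[? ?];
    apply/andP; split; lra.
rewrite !lebesgue_measure_itv/= !lte_fin ltrD2l ltrN2.
by case: ifP => // _; rewrite -!EFinB; congr EFin; lra.
Qed.

Lemma uniform_prob_onem (A : set R) : measurable A ->
  unif (onem @^-1` A) = unif A.
Proof.
move=> mA; rewrite /uniform_prob.
transitivity (\int[pushforward lebesgue_measure
    (onem : _ -> measurableTypeR R)]_(x in A) (uniform_pdf 0 1 x)%:E)%E.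
  rewrite ge0_integral_pushforward//.
  - apply: eq_integral => x _ /=; congr EFin; rewrite /uniform_pdf /onem.
    by congr (if _ then _ else _); apply/idP/idP => /andP[? ?];
      apply/andP; split; lra.
  - by apply/measurable_EFinP/measurable_funTS; exact: measurable_uniform_pdf.
  - by move=> x _; rewrite lee_fin uniform_pdf_ge0.
by apply: eq_measure_integral => B mB _; exact: lebesgue_measure_onem.
Qed.

Lemma uniform_prob_dist0 (c x : R) : unif [set v | `|v - c| = x] = 0%E.
Proof.
apply/eqP; rewrite eq_le measure_ge0 andbT.
apply: (le_trans (y := unif [set c + x; c - x])).
  apply: le_measure; rewrite ?inE.
  - apply: measurable_eq_set => //; apply: measurableT_comp => //.
    exact: measurable_funB.
  - exact: measurableU.
  - move=> v /= <-; case: (ger0P (v - c)) => _; [left|right]; lra.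
rewrite (le_trans (uniform_prob_le_lebesgue _))//; first exact: measurableU.
by rewrite countable_lebesgue_measure0//; apply: finite_set_countable.
Qed.

End uniform_law.

(** * From a Bernoulli vector to a copula *)

Section extremal_mixture.
Context d (T : measurableType d) (R : realType) (P : probability T R).
Context (n : nat) (B : 'I_n -> {RV P >-> R}).
Hypotheses (B01 : bernoulli_vector B) (Bsym : symmetric_margins B).

Local Notation unif := (uniform_prob (@ltr01 R)).
Local Notation S := (T * measurableTypeR R)%type.

Definition randomized : probability S R := (P \x unif)%E.

Local Notation Q := randomized.

(** The affine form of: V if B_i = 1, and 1 - V if B_i = 0, which makes
    measurability immediate. *)
Definition mixture i (z : S) : R :=
  B i z.1 * z.2 + (1 - B i z.1) * (1 - z.2).

Let mB i : measurable_fun setT (fun z : S => B i z.1).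
Proof. exact: measurableT_comp. Qed.

Lemma measurable_mixture i : measurable_fun setT (mixture i).
Proof.
apply: measurable_funD; apply: measurable_funM => //; exact: measurable_funB.
Qed.

HB.instance Definition _ i :=
  isMeasurableFun.Build _ _ _ _ (mixture i) (measurable_mixture i).

Lemma mixture1 i z : B i z.1 = 1 -> mixture i z = z.2.
Proof. by rewrite /mixture => ->; rewrite mul1r subrr mul0r addr0. Qed.

Lemma mixture0 i z : B i z.1 = 0 -> mixture i z = onem z.2.
Proof. by rewrite /mixture => ->; rewrite mul0r add0r subr0 mul1r. Qed.

Definition mixture_vector i : {RV Q >-> R} := mixture i.

Lemma mixture_uniform i : standard_uniform (mixture_vector i).
Proof.
move=> A mA.
rewrite -[LHS]/(\int[P]_t (unif \o xsection (mixture i @^-1` A)) t)%E.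
rewrite (eq_integral (cst (unif A))) => [|t _ /=].
  by rewrite integral_cst// [X in (_ * X)%E]probability_setT mule1.
rewrite xsectionE; have [Bt|Bt] := B01 i t.
  rewrite -[RHS](uniform_prob_onem mA); congr (unif _).
  by apply/funext => v /=; rewrite mixture0.
by congr (unif _); apply/funext => v /=; rewrite mixture1.
Qed.

Lemma mixture_dist i z : `|mixture i z - 2^-1| = `|z.2 - 2^-1 : R|.
Proof.
have [Bz|Bz] := B01 i z.1; last by rewrite mixture1.
by rewrite mixture0// -normrN /onem; congr (`|_|); lra.
Qed.

(** If z is farther from the centre than z', then comparing coordinate k of z
    with that of z' amounts to comparing it with 1/2, and two coordinates of z
    are on the same side of 1/2 exactly when the two bits agree. *)
Lemma mixture_concordant i j (z z' : S) :
  `|z'.2 - 2^-1 : R| < `|z.2 - 2^-1| ->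
  (mixture i z <= mixture i z' /\ mixture j z <= mixture j z') \/
  (mixture i z' <= mixture i z /\ mixture j z' <= mixture j z) <->
  B i z.1 = B j z.1.
Proof.
move=> zz'.
have side k : (mixture k z <= mixture k z') = (mixture k z < 2^-1) /\
    (mixture k z' <= mixture k z) = (2^-1 < mixture k z).
  move: zz'; rewrite -!(mixture_dist k) ltr_norml.
  by case: (ger0P (mixture k z - 2^-1)) => ? /andP[? ?];
    split; apply/idP/idP => ?; lra.
(* z cannot be at the centre, so exactly one side is taken *)
have z2 : z.2 - 2^-1 != 0 :> R.
  by rewrite -normr_gt0; exact: le_lt_trans zz'.
rewrite !(side i).1 !(side i).2 !(side j).1 !(side j).2.
have n01 : 0 <> 1 :> R by move/esym/eqP; rewrite oner_eq0.
have onem_half : onem z.2 < 2^-1 <-> 2^-1 < z.2 :> R.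
  by rewrite /onem; split => ?; lra.
have onem_half' : 2^-1 < onem z.2 <-> z.2 < 2^-1 :> R.
  by rewrite /onem; split => ?; lra.
have tot : z.2 < 2^-1 :> R \/ 2^-1 < z.2 :> R.
  by move: z2; rewrite subr_eq0 neq_lt => /orP.
have asym : z.2 < 2^-1 :> R -> ~ 2^-1 < z.2 :> R.
  by move=> /lt_trans h /h; rewrite ltxx.
have [Bi|Bi] := B01 i z.1; have [Bj|Bj] := B01 j z.1; rewrite Bi Bj.
- by rewrite !mixture0// onem_half onem_half'; tauto.
- rewrite (mixture0 Bi) (mixture1 Bj) onem_half onem_half'.
  by split => [|/n01//]; tauto.
- rewrite (mixture1 Bi) (mixture0 Bj) onem_half onem_half'.
  by split => [|/esym/n01//]; tauto.
- by rewrite !mixture1//; tauto.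
Qed.

Definition eccentricity (z : S) : R := `|(z.2 : R) - 2^-1|.

Lemma measurable_eccentricity : measurable_fun setT eccentricity.
Proof. by apply: measurableT_comp => //; exact: measurable_funB. Qed.

Lemma eccentricity0 x : Q [set z | eccentricity z = x] = 0%E.
Proof.
rewrite -[LHS]/(\int[P]_t
  (unif \o xsection [set z : S | eccentricity z = x]) t)%E.
rewrite integral0_eq// => t _ /=; rewrite -[RHS](uniform_prob_dist0 2^-1 x).
by rewrite xsectionE.
Qed.

Let mecc1 : measurable_fun setT (fun z : S * S => eccentricity z.1).
Proof. exact: measurableT_comp measurable_eccentricity _. Qed.

Let mecc2 : measurable_fun setT (fun z : S * S => eccentricity z.2).
Proof. exact: measurableT_comp measurable_eccentricity _. Qed.

Definition outer_first (E : set T) : set (S * S) :=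
  [set z | E z.1.1 /\ eccentricity z.2 < eccentricity z.1].

Lemma measurable_outer_first E : measurable E -> measurable (outer_first E).
Proof.
move=> mE; apply: measurableI; last exact: measurable_lt_set.
have mfst : measurable_fun setT (fun z : S * S => z.1.1).
  exact: (measurableT_comp measurable_fst measurable_fst).
by rewrite -[X in measurable X]setTI; exact: mfst.
Qed.

(** Being the farther copy depends on the uniform parts only, so that its
    probability c factors out, by Tonelli.  Its value is left unspecified: no
    integral has to be computed, since taking E to be the whole space identifies
    c with the probability 1/2 of [product_lt]. *)
Lemma outer_first_prod : exists c : \bar R, (0 <= c)%E /\
  forall E, measurable E -> (Q \x Q)%E (outer_first E) = (P E * c)%E.
Proof.
pose h (v : measurableTypeR R) :=
  Q [set y | eccentricity y < `|(v : R) - 2^-1|].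
have mh : measurable_fun setT h.
  pose F := [set p : measurableTypeR R * S |
    eccentricity p.2 < `|(p.1 : R) - 2^-1|].
  have mF : measurable F.
    apply: measurable_lt_set.
      exact: (measurableT_comp measurable_eccentricity measurable_snd).
    by apply: measurableT_comp => //; exact: measurable_funB.
  have : measurable_fun setT (Q \o xsection F).
    exact: measurable_fun_xsection.
  by congr measurable_fun; apply/funext => v; rewrite /h/= xsectionE.
have h0 v : (0 <= h v)%E by exact: measure_ge0.
exists (\int[unif]_v h v)%E; split; first exact: integral_ge0.
move=> E mE.
rewrite -[LHS]/(\int[Q]_x (Q \o xsection (outer_first E)) x)%E.
transitivity (\int[Q]_x ((\1_E x.1)%:E * h x.2))%E.
  apply: eq_integral => x _ /=; rewrite xsectionE indicE /outer_first /h.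
  case: (boolP (x.1 \in E)) => [/set_mem Ex|/negP Ex].
    by rewrite mul1e; congr (Q _); apply/seteqP; split => y //= [].
  rewrite mul0e -[RHS](measure0 Q); congr (Q _).
  by apply/seteqP; split => y //= [] /mem_set.
rewrite fubini_tonelli1.
- rewrite /fubini_F/=.
  transitivity (\int[P]_t ((\1_E t)%:E * \int[unif]_v h v))%E.
    by apply: eq_integral => t _; rewrite ge0_integralZl//.
  rewrite ge0_integralZr//.
  + by rewrite integral_indic// setIT.
  + by apply/measurable_EFinP.
  + exact: integral_ge0.
- apply: emeasurable_funM.
    by apply/measurable_EFinP; apply: measurableT_comp.
  exact: (measurableT_comp mh measurable_snd).
- by move=> x; rewrite mule_ge0.
Qed.

Lemma probability_outer_first E : measurable E ->
  fine ((Q \x Q)%E (outer_first E)) = fine (P E) / 2.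
Proof.
move=> mE; have [c [c0 outer_firstE]] := outer_first_prod.
have cE : c = (2^-1)%:E.
  have := product_lt measurable_eccentricity eccentricity0.
  have /(_ measurableT) := outer_firstE setT.
  rewrite probability_setT mul1e => <-.
  have wT : outer_first setT = [set z | eccentricity z.2 < eccentricity z.1].
    by apply/seteqP; split => z //= [].
  rewrite wT => <-; rewrite fineK//.
  by apply: probability_fin_num; exact: measurable_lt_set.
by rewrite outer_firstE// cE fineM// probability_fin_num.
Qed.

(** Up to ties, concordance is the union of two exchanged events, according to
    which copy is the farther one; each has probability P(B_i = B_j) / 2. *)
Lemma kappa_mixture i j :
  kappa mixture_vector i j = fine (P [set w | B i w = B j w]).
Proof.
have mE : measurable [set w | B i w = B j w] by exact: measurable_eq_set.
have mW := measurable_outer_first mE.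
transitivity (2 * fine ((Q \x Q)%E (outer_first [set w | B i w = B j w])));
  last first.
  by rewrite probability_outer_first// mulrC divfK.
rewrite -(product_symmetrize mW); last first.
  by apply: aeW => z [_ /lt_trans h] [_ /h]; rewrite ltxx.
apply: kappa_ae.
  by apply: measurableU => //; exact: measurable_swap_set.
have := product_ties_ae measurable_eccentricity eccentricity0.
apply: filterS => z ties.
rewrite /= /outer_first/=.
have asym : eccentricity z.1 < eccentricity z.2 ->
    ~ eccentricity z.2 < eccentricity z.1.
  by move=> /lt_trans h /h; rewrite ltxx.
have [lt|lt] : eccentricity z.1 < eccentricity z.2 \/
    eccentricity z.2 < eccentricity z.1.
  by move/eqP: ties; rewrite neq_lt => /orP.
- by have := mixture_concordant i j lt; have := asym lt; tauto.
- by have := mixture_concordant i j lt; tauto.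
Qed.

(** As P(B_i = 1) = P(B_j = 1) = 1/2, the events B_i = 1, B_j = 0 and
    B_i = 0, B_j = 1 both have probability 1/2 - P(B_i = B_j = 1). *)
Lemma probability_agree i j : fine (P [set w | B i w = B j w]) =
  2 * fine (P [set w | B i w = 1 /\ B j w = 1]).
Proof.
set A := [set w | B i w = 1]; set A' := [set w | B j w = 1].
have mA : measurable A by exact: measurable_eq_set.
have mA' : measurable A' by exact: measurable_eq_set.
have mE : measurable [set w | B i w = B j w] by exact: measurable_eq_set.
have EE : ~` [set w | B i w = B j w] = (A `\` A') `|` (A' `\` A).
  have n01 : 0 <> 1 :> R by move/esym/eqP; rewrite oner_eq0.
  apply/seteqP; split => w; rewrite /A /A'/=;
    have [Bi|Bi] := B01 i w; have [Bj|Bj] := B01 j w; rewrite Bi Bj.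
  all: intuition.
have mAA' : measurable (A `&` A') by exact: measurableI.
have PA : (P (A `\` A') + P (A `&` A'))%E = (2^-1)%:E.
  by rewrite -measureDI//; exact: Bsym.
have PA' : (P (A' `\` A) + P (A `&` A'))%E = (2^-1)%:E.
  by rewrite setIC -measureDI//; exact: Bsym.
have PU : (P (A `\` A') + P (A' `\` A))%E = (1 - P [set w | B i w = B j w])%E.
  rewrite -probability_setC// EE measureU//; [exact: measurableD..|].
  by apply/seteqP; split => w //= [[_ nA'w] [A'w _]].
move: PA PA' PU; rewrite -[[set w | B i w = 1 /\ _]]/(A `&` A').
rewrite -(fineK (probability_fin_num P mE)).
rewrite -(fineK (probability_fin_num P mAA')).
rewrite -(fineK (probability_fin_num P (measurableD mA mA'))).
rewrite -(fineK (probability_fin_num P (measurableD mA' mA))).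
by rewrite -EFinB -!EFinD => -[?] [?] [?]; lra.
Qed.

Lemma correlation_mixture : correlation_mx B = kendall_mx mixture_vector.
Proof.
apply/matrixP => i j; rewrite !mxE pearson_bernoulli//.
have [<-|ij] := eqVneq i j.
  rewrite (_ : [set w | _] = [set w | B i w = 1]); last first.
    by apply/seteqP; split => w //= [].
  by rewrite Bsym/=; lra.
by rewrite kappa_mixture probability_agree; lra.
Qed.

End extremal_mixture.

Theorem proposition6 (R : realType) (d : nat) (hd : (2 <= d)%N) :
  copula_kendall_matrices R d = symmetric_bernoulli_correlation_matrices R d.
Proof.
apply/seteqP; split => M [disp [T [P]]].
- move=> [U [copU ->]].
  have U0 i x : P [set w | U i w = x] = 0%E by exact: copula_margin_atomless.
  exists _, _, (P \x P)%E, (order_indicator U).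
  split; [exact: bernoulli_order_indicator|exact: symmetric_order_indicator|].
  exact: kendall_order_indicator.
- move=> [B [B01 Bsym ->]].
  exists _, _, (randomized P), (mixture_vector B); split.
    exists _, _, (randomized P), (mixture_vector B); split => // i.
    exact: mixture_uniform.
  exact: correlation_mixture.
Qed.
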